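(* Let $X$ and $Y$ be Polish spaces equipped with Borel probability measures $\mu$ on $X$ and $\nu$ on $Y$, and let $\{T_i\}_{i=1}^k$ be a (finite) sequence of measurable maps from $X$ to $Y$. Assume that: (1) for each $i\in\{2,\dots,k\}$ the map $T_i$ is injective, and $R(T_i)\cap R(T_j)=\emptyset$ for all $2\le i,j\le k$ with $i\ne j$; (2) there exists a bounded measurable function $\theta:Y\to\mathbb{R}$ such that, for each $i\in\{2,\dots,k\}$, $\theta(T_1x)-\theta(T_ix)\ge 0$ for all $x\in X$, and $\theta(T_1x)-\theta(T_ix)=0$ if and only if $T_1x=T_ix$. Then there exists at most one $\gamma\in\Pi(\mu,\nu)$ that is supported on the union of the graphs of $T_1,T_2,\dots,T_k$.
   Context: $\Pi(\mu,\nu)$ is the set of Borel probability measures on $X\times Y$ with marginals $\mu$ and $\nu$. $R(f)$ denotes the range of a map $f$. A measure $\gamma\in\Pi(\mu,\nu)$ is supported on the graphs of measurable maps $T_1,\dots,T_k:X\to Y$ if there exist measurable non-negative functions $\alpha_1,\dots,\alpha_k:X\to\mathbb{R}$ with $\sum_{i=1}^k\alpha_i(x)=1$ such that $\gamma(S)=\sum_{i=1}^k\int_X\alpha_i(x)\chi_S(x,T_ix)\,d\mu(x)$ for each measurable $S\subset X\times Y$, where $\chi_S$ is the indicator function of $S$. *)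

(* Defs.v *)
From HB Require Import structures.
From mathcomp Require Export all_boot all_order all_algebra.
From mathcomp Require Export all_classical all_reals all_analysis.

Set Implicit Arguments.
Unset Strict Implicit.
Unset Printing Implicit Defensive.

Import Order.TTheory GRing.Theory Num.Theory.
Import numFieldNormedType.Exports.

Local Open Scope classical_set_scope.
Local Open Scope ring_scope.

Definition separable (X : topologicalType) : Prop :=
  exists2 D : set X, countable D & dense D.

Definition homeomorphic (X Y : topologicalType) : Prop :=
  exists (f : X -> Y) (g : Y -> X),
    [/\ cancel f g, cancel g f, continuous f & continuous g].

Definition complete_metric (R : realType) (M : metricType R) : Prop :=
  forall u : nat -> M, cauchy (u @ \oo) -> exists l : M, u @ \oo --> l.

(* The metric is not part of the structure: only its existence is required. *)
Definition polish (R : realType) (X : topologicalType) : Prop :=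
  separable X /\
  exists M : metricType R, complete_metric M /\ homeomorphic X M.

(* [X] with its Borel sigma-algebra. For a product, [borelType (X * Y)] is
   generated by the open sets of the product topology, and not by the
   measurable rectangles. *)
Notation borelType X := (g_sigma_algebraType (@open X%type)).

Section plans.
Context {R : realType} {X Y : ptopologicalType}.

(* $\Pi(\mu,\nu)$. Marginals are compared on Borel sets only, because a measure
   is a function on all sets whose values off the sigma-algebra carry no
   meaning. *)
Definition transport_plans (mu : probability (borelType X) R)
    (nu : probability (borelType Y) R) :
    set (probability (borelType (X * Y)) R) :=
  [set gamma |
    (forall A : set (borelType X), measurable A ->
       pushforward gamma (fst : borelType (X * Y) -> borelType X) A = mu A) /\
    (forall B : set (borelType Y), measurable B ->
       pushforward gamma (snd : borelType (X * Y) -> borelType Y) B = nu B)].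

Definition supported_on_graphs (mu : probability (borelType X) R)
    (k : nat) (T : 'I_k -> X -> Y)
    (gamma : probability (borelType (X * Y)) R) : Prop :=
  exists alpha : 'I_k -> borelType X -> R,
    [/\ forall i, measurable_fun [set: borelType X] (alpha i),
        forall i x, 0 <= alpha i x,
        forall x, \sum_(i < k) alpha i x = 1 &
        forall S : set (borelType (X * Y)), measurable S ->
          gamma S =
          (\sum_(i < k) \int[mu]_x (alpha i x * \1_S (x, T i x))%:E)%E].

End plans.

(* Main.v *)
(** Let [a i = alpha i - beta i] be the difference of the weights of two plans;
    then [sum_i a i = 0], and equality of the second marginals says that
    [sum_i int a i f(T i) dmu = 0] for every bounded Borel [f]. As the [T i],
    [i != 0], are injective with disjoint ranges, there is a Borel [s] with
    values in {-1, 0, 1} and [s(T i x) = sgr (a i x)] for almost every [x]. With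
    [f = s 1_B], [B = {theta <= t}], and [a 0 = - sum_(i != 0) a i], one gets
      [sum_(i != 0) int |a i| (1_B(T i) - 1_B(T 0)) dmu <= 0],
    where every term is nonnegative because [theta(T i) <= theta(T 0)]. Letting
    [t] range over the rationals, [a i = 0] almost everywhere on
    [{theta(T i) < theta(T 0)} = {T i <> T 0}], so that both plans put the same
    mass on the graphs. *)
From mathcomp Require Import lra measurable_realfun.
Require Import Defs.
Set Implicit Arguments.
Unset Strict Implicit.
Unset Printing Implicit Defensive.
Import Order.TTheory GRing.Theory Num.Theory.
Import numFieldNormedType.Exports.
Local Open Scope classical_set_scope.
Local Open Scope ring_scope.

(** * Countable bases and dense sequences *)

Definition basis_sequence (X : topologicalType) (B : nat -> set X) :=
  (forall n, open (B n)) /\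
  forall (O : set X) x, open O -> O x -> exists2 n, B n x & B n `<=` O.

Lemma metric_ball_open (R : realType) (M : metricType R) (x : M) (e : R) :
  open (ball x e).
Proof.
rewrite openE => y; rewrite ballEmdist /= => xye.
apply/nbhs_ballP; exists (e - mdist x y); first by rewrite /= subr_gt0.
move=> z; rewrite !ballEmdist /= => yz.
by rewrite (le_lt_trans (metric_triangle x y z))// -ltrBDl.
Qed.

Lemma separable_dense_sequence (X : ptopologicalType) :
  separable X -> exists q : nat -> X, dense (range q).
Proof.
move=> [D /countable_injP[f finj] dD].
(* Inverts the injection of [D] into the naturals. An [n] that is not a value gets the default
   [point], possibly outside [D], which cannot spoil density. *)
exists (fun n => xget point [set x | D x /\ f x = n]) => O O0 oO.
have [x [Ox Dx]] := dD O O0 oO; exists x; split => //.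
exists (f x) => //=.
case: xgetP => [y _ [Dy fyx]|/(_ x)]; last by case.
by apply: finj => //; rewrite inE.
Qed.

(** * Spaces homeomorphic to a metric space *)

Section polish_topology.
Context {R : realType} {X : ptopologicalType} {M : metricType R}.
Variables (f : X -> M) (g : M -> X) (q : nat -> X).
Hypotheses (fK : cancel f g) (gK : cancel g f).
Hypotheses (cf : continuous f) (cg : continuous g) (dq : dense (range q)).

Lemma preimage_ball_open x (e : R) : open (f @^-1` ball x e).
Proof. by move/continuousP : cf; apply; exact: metric_ball_open. Qed.

Lemma open_preimage_ball (O : set X) x : open O -> O x ->
  exists n, f @^-1` ball (f x) n.+1%:R^-1 `<=` O.
Proof.
move=> oO Ox; have /continuousP/(_ _ oO) := cg.
rewrite openE => /(_ (f x)); rewrite /= fK => /(_ Ox) /nbhs_ballP[e /= e0 eO].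
have [n] := ltr_add_invr e0; rewrite add0r => ne.
exists n => y /= /(le_ball (ltW ne)) /eO /=.
by rewrite fK.
Qed.

Lemma dense_ball_cover n : \bigcup_i f @^-1` ball (f (q i)) n.+1%:R^-1 = setT.
Proof.
apply/seteqP; split => // x _.
have [|y [/= xy [i _ qiy]]] :=
    dq _ (preimage_ball_open (f x) n.+1%:R^-1).
  by exists x; exact: ballxx.
by exists i => //=; rewrite qiy; exact: ball_sym.
Qed.

Lemma homeomorphic_basis_sequence : exists B : nat -> set X, basis_sequence B.
Proof.
(* [c] decodes [n] into the index of a centre and that of a radius; a number that codes no pair gets
   a default, harmless since it still yields an open ball. *)
pose c n : nat * nat := odflt (0, 0)%N (unpickle n).
exists (fun n => f @^-1` ball (f (q (c n).1)) (c n).2.+1%:R^-1).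
split => [n|O x oO Ox]; first exact: preimage_ball_open.
have [n nO] := open_preimage_ball oO Ox.
(* The radius is 1/(2n+3): two of them add up to at most 1/(n+1), so a ball of this radius around
   [q i] that contains [x] stays inside [O]. *)
have [i _ /= ix] : (\bigcup_i f @^-1` ball (f (q i)) n.+1.*2.+1%:R^-1) x.
  by rewrite dense_ball_cover.
exists (pickle (i, n.+1.*2)); rewrite /c pickleK//= => y /= iy.
apply: nO => /=.
have e : n.+1.*2.+1%:R^-1 + n.+1.*2.+1%:R^-1 <= n.+1%:R^-1 :> R.
  rewrite -mulr2n -(mulr_natl _ 2) ler_pdivrMr// ler_pdivlMl// -natrM ler_nat.
  by rewrite muln2.
by apply: (le_ball e); apply: ball_triangle iy; exact: ball_sym.
Qed.

Lemma homeomorphic_open_bigcup_closed (O : set X) : open O ->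
  exists2 C : nat -> set X, (forall n, closed (C n)) & O = \bigcup_n C n.
Proof.
move=> oO.
(* The n-th set holds the points whose images under [f] are at distance at least 1/(n+1) from those
   of the complement of [O]. *)
exists (fun n => ~` \bigcup_(y in ~` O) f @^-1` ball (f y) n.+1%:R^-1) => [n|].
  apply: open_closedC; apply: bigcup_open => y _; exact: preimage_ball_open.
apply/seteqP; split => [x Ox|x [n _ /= nx]].
  have [n nO] := open_preimage_ball oO Ox.
  by exists n => // -[y /= nOy /ball_sym yx]; apply: nOy; exact: nO.
by apply: contrapT => Ox; apply: nx; exists x => //; exact: ballxx.
Qed.

(* An ultrafilter on [K] picks one ball of each radius; their centres
   form a Cauchy sequence. *)
Lemma totally_bounded_compact (K : set X) : complete_metric M -> closed K ->
  (forall n, exists N,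
    K `<=` \bigcup_(i < N) f @^-1` ball (f (q i)) n.+1%:R^-1) ->
  compact K.
Proof.
move=> cM cK tbK; rewrite compact_ultra => F FU FK.
have FP : ProperFilter F by exact: ultra_proper.
(* If no ball of the finite cover of [K] were in the ultrafilter, all their complements would be,
   and so would an intersection that misses [K]. *)
have FB n : exists i, F (f @^-1` ball (f (q i)) n.+1%:R^-1).
  apply: contrapT => /forallNP nF.
  have [N KN] := tbK n.
  have : F (\bigcap_(i < N) ~` (f @^-1` ball (f (q i)) n.+1%:R^-1)).
    rewrite bigcap_mkord; elim/big_ind : _ => //.
    - exact: filterT.
    - by move=> A B; exact: filterI.
    - move=> i _.
      by have [/nF|] :=
        in_ultra_setVsetC (f @^-1` ball (f (q i)) n.+1%:R^-1) FU.
  move=> /(filterI FK) /filter_ex[x [/KN[i /= iN fx] /(_ i iN)]]; exact.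
have [u Fu] := choice FB.
have uu n m : ball (f (q (u n))) (n.+1%:R^-1 + m.+1%:R^-1) (f (q (u m))).
  have [x [/= nx /ball_sym mx]] := filter_ex (filterI (Fu n) (Fu m)).
  exact: ball_triangle nx mx.
have invle (e : R) : 0 < e ->
    exists n0 : nat, forall n, (n0 <= n)%N -> n.+1%:R^-1 <= e.
  move=> e0; have [n0] := ltr_add_invr e0; rewrite add0r => /ltW n0e.
  exists n0 => n n0n; apply: le_trans n0e.
  by rewrite lef_pV2 ?posrE// ler_nat ltnS.
have [l ul] : exists l : M, (f \o q \o u) @ \oo --> l.
  apply: cM; apply/cauchy_ballP => e e0.
  have [n0 n0e] := invle (e / 2) (divr_gt0 e0 (ltr0Sn _ 1)).
  pose A := (f \o q \o u) @` [set n | (n0 <= n)%N].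
  have oA : ((f \o q \o u) @ \oo) A by exists n0 => // n n0n; exists n.
  exists (A, A) => // -[_ _] /= [[n n0n <-] [m n0m <-]].
  apply: (le_ball _ (uu n m)).
  by rewrite (splitr e); apply: lerD; exact: n0e.
have Fgl : F --> g l.
  move=> A; rewrite nbhsE => -[U [oU Ul] UA].
  have [n nU] := open_preimage_ball oU Ul.
  have d0 : 0 < n.+1%:R^-1 / 2 :> R by rewrite divr_gt0.
  have [n0 n0e] := invle _ d0.
  have [n1 _ n1l] := ul _ (nbhsx_ballx l _ d0).
  (* Both the radius of the m-th ball and the distance from its centre to [l] are then at most half
     of 1/(n+1). *)
  pose m := maxn n0 n1.
  apply: filterS (Fu m) => x /= mx; apply/UA/nU => /=.
  rewrite gK (splitr n.+1%:R^-1).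
  apply: (ball_triangle (n1l m (leq_maxr _ _))).
  by apply: le_ball mx; exact: n0e (leq_maxl _ _).
exists (g l); split => //; apply: cK => A /Fgl FA.
exact: filter_ex (filterI FK FA).
Qed.

Lemma homeomorphic_hausdorff : hausdorff_space X.
Proof.
move=> x y xy; rewrite -(fK x) -(fK y); congr g.
apply: (@metric_hausdorff R) => A B /cf fA /cf fB.
by have [z [Az Bz]] := xy _ _ fA fB; exists (f z).
Qed.

End polish_topology.

(** * Regularity of finite Borel measures *)

Section regularity.
Context {R : realType}.

Lemma measure_bigcup_geometric (d : measure_display) (T : measurableType d)
    (mu : {measure set T -> \bar R}) (A : nat -> set T) (e : R) : 0 <= e ->
  (forall n, measurable (A n)) ->
  (forall n, mu (A n) <= (e / (2 ^ n.+1)%:R)%:E)%E ->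
  (mu (\bigcup_n A n) <= e%:E)%E.
Proof.
move=> e0 mA Ae.
apply: le_trans (epsilon_trick0 xpredT e0).
apply: (@le_trans _ _ (\sum_(0 <= n <oo) mu (A n))%E).
  apply: measure_sigma_subadditive => //; exact: bigcup_measurable.
by apply: lee_nneseries => // n _; exact: measure_ge0.
Qed.

(** Continuity from above along the decreasing sets left after removing finitely many [C i]; the
    strict bound on the limit passes to some term. *)
Lemma measure_setD_bigcup_finite (d : measure_display) (T : measurableType d)
    (mu : {finite_measure set T -> \bar R}) (A : set T) (C : nat -> set T)
    (e : R) :
  measurable A -> (forall n, measurable (C n)) ->
  (mu (A `\` \bigcup_n C n) < e%:E)%E ->
  exists N, (mu (A `\` \bigcup_(i < N) C i) <= e%:E)%E.
Proof.
move=> mA mC Ce.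
pose G N := A `\` \bigcup_(i < N) C i.
have mG N : measurable (G N).
  apply: measurableD => //; exact: bigcup_measurable.
have capG : \bigcap_N G N = A `\` \bigcup_n C n.
  apply/seteqP; split => [x Gx|x [Ax Cx] N _].
    split; first by have [] := Gx 0%N I.
    by move=> [n _ Cnx]; have [_] := Gx n.+1 I; apply; exists n => /=.
  by split => // -[i _ Cix]; apply: Cx; exists i.
have G0 : (mu (G 0%N) < +oo)%E by rewrite -ge0_fin_numE ?fin_num_measure.
have Gdec : {homo G : n m / (n <= m)%N >-> (m <= n)%O}.
  move=> n m nm; apply/subsetPset => x [Ax Cx]; split => // -[i /= im Cix].
  by apply: Cx; exists i => //=; exact: leq_trans nm.
have mI : measurable (\bigcap_N G N) by exact: bigcapT_measurable.
have := nonincreasing_cvg_mu G0 mG mI Gdec.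
rewrite capG => Gcvg.
apply: contrapT => /forallNP nG.
have : (e%:E <= mu (A `\` \bigcup_n C n))%E.
  rewrite -(cvg_lim _ Gcvg)//; apply: lime_ge.
    by apply/cvg_ex; exists (mu (A `\` \bigcup_n C n)).
  by apply: nearW => N; apply: ltW; rewrite ltNge; apply/negP/nG.
by rewrite leNgt Ce.
Qed.

Context {X : ptopologicalType}.
Variable mu : {finite_measure set (borelType X) -> \bar R}.

Lemma open_measurable_borel (A : set X) :
  open A -> measurable (A : set (borelType X)).
Proof. exact: sub_sigma_algebra. Qed.

Lemma closed_measurable_borel (A : set X) :
  closed A -> measurable (A : set (borelType X)).
Proof.
move=> cA; rewrite -(setCK A); apply: measurableC; apply: open_measurable_borel.
exact: closed_openC.
Qed.

Hypothesis openF : forall O : set X, open O ->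
  exists2 C : nat -> set X, (forall n, closed (C n)) & O = \bigcup_n C n.

(** The sets that can be squeezed between a closed and an open set form a sigma-algebra, and it
    contains the open sets because they are countable unions of closed sets. *)
Lemma borel_regular (A : set (borelType X)) (e : R) : measurable A -> 0 < e ->
  exists F O : set X, [/\ closed F, open O, F `<=` A, A `<=` O &
    (mu (O `\` F) <= e%:E)%E].
Proof.
move=> mA; move: e.
pose P (A : set (borelType X)) := forall e : R, 0 < e -> 
  exists F O : set X, [/\ closed F, open O, F `<=` A, A `<=` O &
    (mu (O `\` F) <= e%:E)%E].
suff : <<s @open X >> `<=` P by apply.
apply: smallest_sub; last first.
  move=> O oO e e0; have [C cC OE] := openF oO.
  have mC n : measurable (C n : set (borelType X)) by exact: closed_measurable_borel.
  have mO : measurable (O : set (borelType X)) by exact: open_measurable_borel.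
  have [|N CN] := @measure_setD_bigcup_finite _ _ mu O C e mO mC.
    by rewrite -OE setDv measure0 lte_fin.
  exists (\bigcup_(i < N) C i), O; split => //.
  - by apply: closed_bigcup => //; exact: finite_II.
  - by rewrite OE => x [i _ Cx]; exists i.
split => [e e0|B PB e e0|B PB e e0].
- exists set0, set0; split => //; first exact: closed0. exact: open0.
  by rewrite setD0 measure0 lee_fin ltW.
- have [F [U [cF oU FB BU UFe]]] := PB e e0.
  exists (~` U), (~` F); split.
  + exact: open_closedC.
  + exact: closed_openC.
  + by rewrite setTD; exact: subsetC.
  + by rewrite setTD; exact: subsetC.
  + by rewrite setDE setCK setIC -setDE.
- have e20 : 0 < e / 2 by rewrite divr_gt0.
  have en0 n : 0 < e / 2 / (2 ^ n.+1)%:R by rewrite divr_gt0// ltr0n expn_gt0.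
  have /choice[F] n := PB n _ (en0 n).
  move=> /choice[U FU].
  have mU0 n : measurable (U n : set (borelType X)).
    by have [] := FU n; move=> *; exact: open_measurable_borel.
  have mF n : measurable (F n : set (borelType X)).
    by have [] := FU n; move=> *; exact: closed_measurable_borel.
  have mU : measurable (\bigcup_n U n : set (borelType X)) by exact: bigcup_measurable.
  (* A countable union of closed sets need not be closed, so it is cut at a finite [N]; aiming at
     [e / 2] leaves the strict inequality that the cut requires. *)
  have [|N FN] := @measure_setD_bigcup_finite _ _ mu (\bigcup_n U n) F e mU mF.
    apply: (@le_lt_trans _ _ (e / 2)%:E); last first.
      by rewrite lte_fin ltr_pdivrMr// ltr_pMr// ltr1n.
    apply: (@le_trans _ _ (mu (\bigcup_n (U n `\` F n)))).
      apply: le_measure; rewrite ?inE.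
      + by apply: measurableD => //; exact: bigcup_measurable.
      + by apply: bigcup_measurable => n _; exact: measurableD.
      + by move=> x [[n _ Ux] nF]; exists n => //; split => // Fx; apply: nF; exists n.
    apply: measure_bigcup_geometric; first exact: ltW.
      by move=> n; exact: measurableD.
    by move=> n; have [] := FU n.
  exists (\bigcup_(i < N) F i), (\bigcup_n U n); split => //.
  + by apply: closed_bigcup; [exact: finite_II|move=> i _; have [] := FU i].
  + by apply: bigcup_open => i _; have [] := FU i.
  + by move=> x [i _ Fx]; exists i => //; have [_ _ FB _ _] := FU i; exact: FB.
  + by move=> x [i _ Bx]; exists i => //; have [_ _ _ BU _] := FU i; exact: BU.
Qed.

(* Ulam tightness and Lusin's theorem are both instances: [Q n C] is "finitely
   many balls of radius 1/(n+1) cover [C]", resp. "the preimage of the n-th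
   basic open set is relatively open in [C]". *)
Lemma closed_hereditary (Q : nat -> set X -> Prop) :
  (forall n (A B : set X), A `<=` B -> Q n B -> Q n A) ->
  (forall n (e : R), 0 < e ->
     exists C : set X, [/\ closed C, Q n C & (mu (~` C) <= e%:E)%E]) ->
  forall e : R, 0 < e -> exists C : set X,
    [/\ closed C, forall n, Q n C & (mu (~` C) <= e%:E)%E].
Proof.
move=> Qsub Qex e e0.
have en0 n : 0 < e / (2 ^ n.+1)%:R by rewrite divr_gt0// ltr0n expn_gt0.
have /choice[C HC] n := Qex n _ (en0 n).
exists (\bigcap_n C n); split.
- by apply: closed_bigI => n _; have [] := HC n.
- by move=> n; have [_ QC _] := HC n; apply: Qsub QC; exact: bigcap_inf.
- rewrite setC_bigcap; apply: measure_bigcup_geometric; first exact: ltW.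
    move=> n; apply: open_measurable_borel; apply: closed_openC.
    by have [] := HC n.
  by move=> n; have [] := HC n.
Qed.

End regularity.

(** * Images of Borel sets under Borel maps between Polish spaces *)

Section polish_images.
Context {R : realType} {X Y : ptopologicalType}.
Hypotheses (polishX : polish R X) (polishY : polish R Y).

Lemma polish_basis_sequence (Z : ptopologicalType) : polish R Z ->
  exists B : nat -> set Z, basis_sequence B.
Proof.
move=> [/separable_dense_sequence[q dq] [M [_ [f [g [fK gK cf cg]]]]]].
exact: (homeomorphic_basis_sequence fK cf cg dq).
Qed.

Lemma polish_hausdorff (Z : ptopologicalType) : polish R Z -> hausdorff_space Z.
Proof.
by move=> [_ [M [_ [f [g [fK gK cf cg]]]]]]; exact: (homeomorphic_hausdorff fK cf).
Qed.

Lemma basis_sequence_subspace_continuous (B : nat -> set Y) (T : X -> Y)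
    (K : set X) : basis_sequence B ->
  (forall n, exists2 U : set X, open U & U `&` K = T @^-1` B n `&` K) ->
  {within K, continuous T}.
Proof.
move=> [oB basB] BK; apply/continuousP => V oV; apply/open_subspaceP.
have [U HU] : {U : nat -> set X & forall n,
    open (U n) /\ U n `&` K = T @^-1` B n `&` K}.
  apply: (@choice _ _ (fun n U => open U /\ U `&` K = T @^-1` B n `&` K)) => n.
  by have [U oU UK] := BK n; exists U.
exists (\bigcup_(n in [set n | B n `<=` V]) U n).
  by apply: bigcup_open => n _; have [] := HU n.
apply/seteqP; split => [x [[n /= nV Ux] Kx]|x [Vx Kx]].
  split => //; apply: nV; have [_ UK] := HU n.
  by have [] : (T @^-1` B n `&` K) x by rewrite -UK.
have [n Bx nV] := basB V (T x) oV Vx.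
split => //; exists n => //; have [_ UK] := HU n.
by have [] : (U n `&` K) x by rewrite UK.
Qed.

(** [K] is the intersection of a totally bounded closed set (Ulam), a closed set on which [T] is
    continuous (Lusin) and a closed subset of [P], each at the cost of [e / 3]. It is compact, so
    its image is compact, hence closed and Borel. *)
Lemma polish_image_approx (mu : {finite_measure set (borelType X) -> \bar R})
    (T : borelType X -> borelType Y) (P : set (borelType X)) (e : R) :
  measurable_fun setT T -> measurable P -> 0 < e ->
  exists K : set (borelType X), [/\ measurable K, K `<=` P,
    measurable (T @` K) & (mu (P `\` K) <= e%:E)%E].
Proof.
move=> mT mP e0.
have [/separable_dense_sequence[q dq] [M [cM [f [g [fK gK cf cg]]]]]] := polishX.
have [B [oB basB]] := polish_basis_sequence polishY.
have reg := borel_regular mu (homeomorphic_open_bigcup_closed fK cf cg).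
have e30 : 0 < e / 3 by rewrite divr_gt0.
have [C1 [cC1 tbC1 C1e]] : exists C : set X, [/\ closed C,
    forall n, exists N, C `<=` \bigcup_(i < N) f @^-1` ball (f (q i)) n.+1%:R^-1
    & (mu (~` C) <= (e / 3)%:E)%E].
  apply: closed_hereditary e30.
    by move=> n A A' AA' [N A'N]; exists N; exact: subset_trans A'N.
  move=> n d d0.
  pose b i : set (borelType X) := f @^-1` ball (f (q i)) n.+1%:R^-1.
  have mb i : measurable (b i).
    by apply: open_measurable_borel; exact: preimage_ball_open.
  have d20 : 0 < d / 2 by rewrite divr_gt0.
  (* Half of [d] pays for keeping finitely many balls, the other half for shrinking their union to a
     closed set. *)
  have [|N bN] :=
      @measure_setD_bigcup_finite _ _ _ mu setT b (d / 2) measurableT mb.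
    by rewrite (dense_ball_cover cf dq) setDv measure0 lte_fin.
  have mbN : measurable (\bigcup_(i < N) b i) by exact: bigcup_measurable.
  have [F [U [cF oU FA AU UFd]]] := reg _ _ mbN d20.
  exists F; split => //; first by exists N.
  have mF : measurable (F : set (borelType X)) by exact: closed_measurable_borel.
  have mU : measurable (U : set (borelType X)) by exact: open_measurable_borel.
  rewrite (splitr d) EFinD.
  apply: (@le_trans _ _ (mu ((setT `\` \bigcup_(i < N) b i) `|` (U `\` F)))).
    apply: le_measure; rewrite ?inE.
    - exact: measurableC.
    - by apply: measurableU; exact: measurableD.
    - move=> x nFx; have [Ax|nAx] := pselect ((\bigcup_(i < N) b i) x).
        by right; split => //; exact: AU.
      by left; split.
  apply: le_trans (measureU2 _ _ _) _; [exact: measurableD|exact: measurableD|].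
  exact: leeD.
have [C2 [cC2 conC2 C2e]] : exists C : set X, [/\ closed C,
    forall n, exists2 U : set X, open U & U `&` C = T @^-1` B n `&` C
    & (mu (~` C) <= (e / 3)%:E)%E].
  apply: closed_hereditary e30.
    move=> n A A' AA' [U oU UA']; exists U => //.
    by rewrite -(setIidr AA') !setIA UA'.
  move=> n d d0.
  have mB : measurable (T @^-1` B n).
    by rewrite -(setTI (_ @^-1` _)); apply: mT => //; exact: open_measurable_borel.
  have [F [U [cF oU FA AU UFd]]] := reg _ _ mB d0.
  (* [F] lies in the preimage of [B n] and the preimage in [U], so on this closed set the preimage
     coincides with the open set [U]; only the part of [U] outside [F] is lost. *)
  exists (F `|` ~` U); split.
  - by apply: closedU => //; exact: open_closedC.
  - exists U => //; apply/seteqP; split => x [Ux FUx]; split => //.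
      by case: FUx => [/FA//|/(_ Ux)].
    exact: AU.
  - by rewrite setCU setCK setIC -setDE.
have [F [U [cF oU FP PU UFe]]] := reg _ _ mP e30.
pose K := C1 `&` C2 `&` F.
have cK : closed K by apply: closedI => //; exact: closedI.
have coK : compact K.
  apply: (totally_bounded_compact fK gK cg cM cK) => n.
  by have [N CN] := tbC1 n; exists N => x [[C1x _] _]; exact: CN.
have conK : {within K, continuous (T : X -> Y)}.
  apply: (basis_sequence_subspace_continuous (conj oB basB)) => n.
  have [V oV VC] := conC2 n; exists V => //.
  have KC : K `<=` C2 by move=> x [[]].
  by rewrite -(setIidr KC) !setIA VC.
exists K; split.
- exact: closed_measurable_borel.
- by move=> x [_ /FP].
- apply: closed_measurable_borel; apply: compact_closed.
    exact: polish_hausdorff.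
  exact: continuous_compact.
- have mC1 : measurable (C1 : set (borelType X)) by exact: closed_measurable_borel.
  have mC2 : measurable (C2 : set (borelType X)) by exact: closed_measurable_borel.
  have mF : measurable (F : set (borelType X)) by exact: closed_measurable_borel.
  have mK : measurable (K : set (borelType X)) by exact: closed_measurable_borel.
  have mU : measurable (U : set (borelType X)) by exact: open_measurable_borel.
  have -> : e = e / 3 + e / 3 + e / 3 by lra.
  rewrite !EFinD.
  apply: (@le_trans _ _ (mu (~` C1 `|` ~` C2 `|` (U `\` F)))).
    apply: le_measure; rewrite ?inE.
    - exact: measurableD.
    - apply: measurableU; last exact: measurableD.
      by apply: measurableU; exact: measurableC.
    - move=> x [Px nKx].
      have [C1x|] := pselect (C1 x); last by left; left.
      have [C2x|] := pselect (C2 x); last by left; right.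
      by right; split; [exact: PU|move=> Fx; apply: nKx].
  apply: le_trans (measureU2 _ _ _) _.
  + by apply: measurableU; exact: measurableC.
  + exact: measurableD.
  + apply: leeD => //; apply: le_trans (measureU2 _ _ _) _.
    * exact: measurableC.
    * exact: measurableC.
    * exact: leeD.
Qed.

(* Measure-theoretic substitute for the Lusin-Souslin theorem: [T @` P'] is
   sigma-compact. *)
Lemma polish_image_ae (mu : {finite_measure set (borelType X) -> \bar R})
    (T : borelType X -> borelType Y) (P : set (borelType X)) :
  measurable_fun setT T -> measurable P ->
  exists P' : set (borelType X), [/\ P' `<=` P, measurable (T @` P') &
    mu.-negligible (P `\` P')].
Proof.
move=> mT mP.
have n0 n : 0 < n.+1%:R^-1 :> R by rewrite invr_gt0.
have /choice[K HK] n := polish_image_approx mu mT mP (n0 n).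
exists (\bigcup_n K n); split.
- by move=> x [n _]; have [_ KP _ _] := HK n; exact: KP.
- rewrite image_bigcup; apply: bigcup_measurable => n _.
  by have [] := HK n.
- have mK n : measurable (K n) by have [] := HK n.
  have mU : measurable (\bigcup_n K n) by exact: bigcup_measurable.
  apply/negligibleP; first exact: measurableD.
  apply/eqP; rewrite eq_le measure_ge0 andbT.
  apply/lee_addgt0Pr => d d0; rewrite add0e.
  have [n] := ltr_add_invr d0; rewrite add0r => nd.
  apply: (@le_trans _ _ (mu (P `\` K n))).
    apply: le_measure; rewrite ?inE; [exact: measurableD|exact: measurableD|].
    by apply: setDS; exact: bigcup_sup.
  have [_ _ _ /le_trans] := HK n; apply.
  by rewrite lee_fin ltW.
Qed.

End polish_images.

(** * Ordered functions with equal integrals *)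

(** The difference of [p] and [q] is nonnegative almost everywhere and integrates to 0. The bound
    [C] on a finite measure makes both integrable, so that the integrals can be subtracted. *)
Lemma ae_eq_le_integral (d : measure_display) (T : measurableType d)
    (R : realType) (mu : {finite_measure set T -> \bar R}) (p q : T -> R)
    (C : R) :
  measurable_fun setT p -> measurable_fun setT q ->
  (forall x, `|p x| <= C) -> (forall x, `|q x| <= C) ->
  {ae mu, forall x, q x <= p x} ->
  (\int[mu]_x (p x)%:E = \int[mu]_x (q x)%:E)%E ->
  {ae mu, forall x, p x = q x}.
Proof.
move=> mp mq pC qC qp pq.
have fin : (mu setT < +oo)%E by rewrite -ge0_fin_numE ?fin_num_measure.
have bint (h : T -> R) : measurable_fun setT h -> (forall x, `|h x| <= C) ->
    mu.-integrable setT (EFin \o h).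
  move=> mh hC; apply: measurable_bounded_integrable => //.
  exists C; split; first exact: num_real.
  by move=> M CM x _; exact: le_trans (hC x) (ltW CM).
have ip := bint p mp pC; have iq := bint q mq qC.
have mpq : measurable_fun setT (EFin \o (p \- q : T -> R)).
  by apply/measurable_EFinP; exact: measurable_funB.
have : (\int[mu]_x `|(p x - q x)%:E| = 0)%E.
  transitivity (\int[mu]_x (p x - q x)%:E)%E.
    apply: ae_eq_integral => //; first exact: measurableT_comp.
    by apply: filterS qp => x qpx _; rewrite /= ger0_norm// subr_ge0.
  under eq_integral do rewrite EFinB.
  rewrite integralB_EFin// pq subee//.
  by apply: integrable_fin_num.
move=> /(ae_eq_integral_abs mu measurableT mpq).
by apply: filterS => x /(_ I) [] /eqP; rewrite subr_eq0 => /eqP.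
Qed.

(** * Borel sets of the product and graph maps *)

Section borel_product.
Context {R : realType} {X Y : ptopologicalType}.

Lemma measurable_snd_borel :
  measurable_fun setT (snd : borelType (X * Y) -> borelType Y).
Proof.
apply: (@measurability _ _ _ (borelType Y) _ _ (@open Y)) => //.
move=> _ [B oB <-]; rewrite setTI; apply: sub_sigma_algebra.
have cs : continuous (snd : X * Y -> Y) by move=> x; exact: cvg_snd.
by move/continuousP : cs; apply.
Qed.

(** The sigma-algebra is generated by all open sets of the product, so measurability of the
    coordinates is not enough by itself: countable bases write an open set as a countable union of
    open rectangles. *)
Lemma measurable_graph_borel (T : borelType X -> borelType Y) :
  polish R X -> polish R Y -> measurable_fun setT T ->
  measurable_fun setT (fun x => (x, T x) : borelType (X * Y)).
Proof.
move=> /polish_basis_sequence[B [oB basB]] /polish_basis_sequence[V [oV basV]] mT.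
apply: (@measurability _ _ _ (borelType (X * Y)) _ _ (@open (X * Y)%type)) => //.
move=> _ [W oW <-]; rewrite setTI.
have -> : (fun x => (x, T x)) @^-1` W =
    \bigcup_n \bigcup_(m in [set m | B n `*` V m `<=` W]) (B n `&` T @^-1` V m).
  apply/seteqP; split => [x /= Wx|x [n _ [m /= BVW [Bx Vx]]]]; last exact: BVW.
  have /= := oW; rewrite openE => /(_ _ Wx) [[A C] [/= nA nC] AC].
  move: nA nC; rewrite !nbhsE => -[A' [oA' A'x] A'A] [C' [oC' C'x] C'C].
  have [n Bx BA] := basB _ _ oA' A'x.
  have [m Vx VC] := basV _ _ oC' C'x.
  exists n => //; exists m => //= -[y z] [/= By Vz]; apply: AC; split => /=.
    exact/A'A/BA.
  exact/C'C/VC.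
apply: bigcup_measurable => n _; apply: bigcup_measurable => m _.
apply: measurableI; first exact: open_measurable_borel.
by rewrite -[X in measurable X]setTI; apply: mT => //; exact: open_measurable_borel.
Qed.

End borel_product.

(** * Comparison of the weights of two plans *)

Section graph_weights.
Context {R : realType} {X Y : ptopologicalType}.
Variables (mu : probability (borelType X) R) (k : nat).
Variable T : 'I_k.+1 -> borelType X -> borelType Y.
Hypothesis mT : forall i, measurable_fun setT (T i).

(** Its integral against [mu] is the mass of [S] under the plan with weights [w]. Keeping the sum
    inside the integral lets two plans be compared pointwise. *)
Definition graph_mass (w : 'I_k.+1 -> borelType X -> R)
    (S : set (borelType (X * Y))) (x : borelType X) : R :=
  \sum_(i < k.+1) w i x * \1_S (x, T i x).

Hypotheses (polishX : polish R X) (polishY : polish R Y).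

Lemma measurable_graph_indic i (S : set (borelType (X * Y))) : measurable S ->
  measurable_fun setT (fun x => \1_S (x, T i x) : R).
Proof.
move=> mS.
have mG := measurable_graph_borel polishX polishY (mT i).
exact: (measurableT_comp (measurable_indic mS) mG).
Qed.

Section weights.
Variable w : 'I_k.+1 -> borelType X -> R.
Hypotheses (mw : forall i, measurable_fun setT (w i)).
Hypotheses (w0 : forall i x, 0 <= w i x)
  (w1 : forall x, \sum_(i < k.+1) w i x = 1).

Lemma measurable_graph_mass S : measurable S ->
  measurable_fun setT (graph_mass w S).
Proof.
move=> mS; apply: measurable_sum => i; apply: measurable_funM => //.
exact: measurable_graph_indic.
Qed.

Lemma graph_mass_ge0 S x : 0 <= graph_mass w S x.
Proof. by apply: sumr_ge0 => i _; rewrite mulr_ge0// indicE. Qed.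

Lemma graph_mass_le1 S x : graph_mass w S x <= 1.
Proof.
by rewrite -(w1 x); apply: ler_sum => i _; rewrite ler_piMr// indicE.
Qed.

Lemma integral_graph_mass S : measurable S ->
  (\int[mu]_x (graph_mass w S x)%:E =
   \sum_(i < k.+1) \int[mu]_x (w i x * \1_S (x, T i x))%:E)%E.
Proof.
move=> mS; rewrite -ge0_integral_sum//.
- by apply: eq_integral => x _; rewrite sumEFin.
- move=> i; apply/measurable_EFinP; apply: measurable_funM => //.
  exact: measurable_graph_indic.
- by move=> i x _; rewrite lee_fin mulr_ge0// indicE.
Qed.

End weights.

Variables alpha beta : 'I_k.+1 -> borelType X -> R.
Hypotheses (malpha : forall i, measurable_fun setT (alpha i))
  (alpha0 : forall i x, 0 <= alpha i x)
  (alpha1 : forall x, \sum_(i < k.+1) alpha i x = 1).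
Hypotheses (mbeta : forall i, measurable_fun setT (beta i))
  (beta0 : forall i x, 0 <= beta i x)
  (beta1 : forall x, \sum_(i < k.+1) beta i x = 1).

Let a i x := alpha i x - beta i x.

(** The [a i x] sum to 0, so a common value may be subtracted from the indicators. Only maps that
    differ from [T ord0] at [x] contribute. *)
Lemma graph_massB S x : graph_mass alpha S x - graph_mass beta S x =
  \sum_(i < k.+1) a i x * (\1_S (x, T i x) - \1_S (x, T ord0 x)).
Proof.
rewrite /graph_mass -sumrB.
transitivity (\sum_(i < k.+1) a i x * \1_S (x, T i x)).
  by apply: eq_bigr => i _; rewrite mulrBl.
transitivity (\sum_(i < k.+1) a i x * \1_S (x, T i x)
  - (\sum_(i < k.+1) a i x) * \1_S (x, T ord0 x)).
  by rewrite sumrB alpha1 beta1 subrr mul0r subr0.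
by rewrite mulr_suml -sumrB; apply: eq_bigr => i _; rewrite mulrBr.
Qed.

Hypothesis injT : forall i, i != ord0 -> injective (T i).
Hypothesis disjT : forall i j, i != ord0 -> j != ord0 -> i != j ->
  range (T i) `&` range (T j) = set0.
Variable theta : borelType Y -> R.
Hypothesis mtheta : measurable_fun setT theta.
Hypothesis theta_le : forall i x, i != ord0 ->
  theta (T i x) <= theta (T ord0 x).
Hypothesis theta_eq : forall i x, i != ord0 ->
  theta (T i x) = theta (T ord0 x) -> T ord0 x = T i x.
Hypothesis marginal : forall B : set (borelType Y), measurable B ->
  (\int[mu]_x (graph_mass alpha (snd @^-1` B) x)%:E =
   \int[mu]_x (graph_mass beta (snd @^-1` B) x)%:E)%E.

(* [\1_Sp - \1_Sn] is a Hahn density of the signed measure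
   sum_(i != 0) (T i)_# (a i mu): injectivity and disjoint ranges make it
   [sgr (a i)] along each [T i]. The sets are images of Borel sets, whence the
   need for [polish_image_ae]. *)
Lemma sign_separation : exists Sp Sn : set (borelType Y),
  [/\ measurable Sp, measurable Sn & {ae mu, forall x, forall i, i != ord0 ->
    a i x * (\1_Sp (T i x) - \1_Sn (T i x)) = `|a i x|}].
Proof.
have ma i : measurable_fun setT (a i) by exact: measurable_funB.
have mlt (f g : borelType X -> R) : measurable_fun setT f ->
    measurable_fun setT g -> measurable [set x | f x < g x].
  move=> mf mg; rewrite -[X in measurable X]setTI.
  exact: (measurable_fun_ltr mf mg measurableT (Y := [set true])).
have mP i : measurable [set x | 0 < a i x] by exact: mlt.
have mN i : measurable [set x | a i x < 0] by exact: mlt.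
have /choice[P HP] i := polish_image_ae polishX polishY mu (mT i) (mP i).
have /choice[N HN] i := polish_image_ae polishX polishY mu (mT i) (mN i).
pose I0 : set 'I_k.+1 := [set i | i != ord0].
exists (\bigcup_(i in I0) T i @` P i), (\bigcup_(i in I0) T i @` N i); split.
- apply: fin_bigcup_measurable => [|i _]; first exact: finite_finset.
  by have [] := HP i.
- apply: fin_bigcup_measurable => [|i _]; first exact: finite_finset.
  by have [] := HN i.
(* Injectivity and disjoint ranges allow [T i x] to enter the union only as the image of [x] itself
   under [T i]. *)
have inI (A : 'I_k.+1 -> set (borelType X)) i x : i != ord0 ->
    (\bigcup_(i in I0) T i @` A i) (T i x) <-> A i x.
  move=> i0; split => [[j /= j0 [y Ay Tyx]]|Ax]; last by exists i => //; exists x.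
  have [ij|ij] := eqVneq i j.
    by move: j0 Ay Tyx; rewrite -ij => _ Ay /(injT i0) <-.
  have : (range (T i) `&` range (T j)) (T i x) by split; [exists x|exists y].
  by rewrite disjT.
have aeP : {ae mu, forall x, forall i, 0 < a i x -> P i x}.
  apply: filter_forall => i; have [_ _] := HP i.
  by apply: negligibleS => x /= /not_implyP.
have aeN : {ae mu, forall x, forall i, a i x < 0 -> N i x}.
  apply: filter_forall => i; have [_ _] := HN i.
  by apply: negligibleS => x /= /not_implyP.
apply: filterS2 aeP aeN => x Px Nx i i0.
have memE (A : 'I_k.+1 -> set (borelType X)) :
    (T i x \in \bigcup_(i in I0) T i @` A i) = (x \in A i).
  by apply/idP/idP; rewrite !inE => /(inI A i x i0).
rewrite !indicE !memE.
have [ai|ai|->] := ltgtP (a i x) 0; last by rewrite mul0r normr0.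
- rewrite (mem_set (Nx i ai)) memNset ?sub0r ?mulrN1 ?ltr0_norm//.
  by have [PP _ _] := HP i => /PP /=; rewrite ltNge ltW.
- rewrite (mem_set (Px i ai)) memNset ?subr0 ?mulr1 ?gtr0_norm//.
  by have [NN _ _] := HN i => /NN /=; rewrite ltNge ltW.
Qed.

Lemma graph_weights_ae :
  {ae mu, forall x, forall i, T i x <> T ord0 x -> alpha i x = beta i x}.
Proof.
have [Sp [Sn [mSp mSn HS]]] := sign_separation.
(* Rational thresholds are enumerated through [unpickle], so that countably many null sets are
   united. *)
have aet : {ae mu, forall x, forall (n : nat) (t : rat), unpickle n = Some t ->
    forall i, theta (T i x) <= ratr t -> ratr t < theta (T ord0 x) ->
    a i x = 0}.
  apply: ae_foralln => n.
  case: (unpickle n) => [t|]; last by apply: aeW.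
  pose B := [set y | theta y <= ratr t].
  have mB : measurable B.
    by rewrite -[X in measurable X]setTI; apply: measurable_fun_le.
  pose Bp := B `&` Sp; pose Bn := B `&` Sn.
  have mBp : measurable (snd @^-1` Bp : set (borelType (X * Y))).
    rewrite -[X in measurable X]setTI; apply: measurable_snd_borel => //.
    exact: measurableI.
  have mBn : measurable (snd @^-1` Bn : set (borelType (X * Y))).
    rewrite -[X in measurable X]setTI; apply: measurable_snd_borel => //.
    exact: measurableI.
  (* [p - q] is the density obtained by testing the difference of the plans against the indicator of
     [B] times the sign. Moving the negative terms across leaves sums of nonnegative masses, whose
     integrals agree by the marginal condition on [Bp] and [Bn]. *)
  pose p x :=
    graph_mass alpha (snd @^-1` Bp) x + graph_mass beta (snd @^-1` Bn) x.
  pose q x :=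
    graph_mass beta (snd @^-1` Bp) x + graph_mass alpha (snd @^-1` Bn) x.
  have pqE x : p x - q x = \sum_(i < k.+1) a i x *
     ((\1_B (T i x) * (\1_Sp (T i x) - \1_Sn (T i x))) -
      (\1_B (T ord0 x) * (\1_Sp (T ord0 x) - \1_Sn (T ord0 x)))).
    transitivity (
      (graph_mass alpha (snd @^-1` Bp) x - graph_mass beta (snd @^-1` Bp) x) -
      (graph_mass alpha (snd @^-1` Bn) x - graph_mass beta (snd @^-1` Bn) x)).
      by rewrite /p /q; lra.
    rewrite !graph_massB -sumrB; apply: eq_bigr => i _.
    have E (A : set (borelType Y)) z :
        \1_(snd @^-1` (B `&` A)) (x, z) = \1_B z * \1_A z :> R.
      by rewrite -[RHS]/((\1_B \* \1_A) z) -indicI.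
    by rewrite !E; lra.
  have le2 u v : 0 <= u <= 1 -> 0 <= v <= 1 -> `|u + v : R| <= 2.
    by move=> /andP[? ?] /andP[? ?]; rewrite ger0_norm; lra.
  (* Here [c] is [a i x]; [b] and [s] are the values at [T i x] of the indicator of [B] and of the
     sign, [b0] and [s0] those at [T ord0 x]. *)
  have key (c b b0 s s0 : R) : c * s = `|c| -> c * s0 <= `|c| -> 0 <= b0 ->
      `|c| * (b - b0) <= c * (b * s - b0 * s0).
    move=> cs cs0 b00; rewrite mulrBr (mulrBr c) (mulrCA c b) cs (mulrCA c b0).
    by rewrite (mulrC b) lerB// [leRHS]mulrC ler_wpM2l.
  have terms : {ae mu, forall x, forall i,
      `|a i x| * (\1_B (T i x) - \1_B (T ord0 x)) <=
      a i x * ((\1_B (T i x) * (\1_Sp (T i x) - \1_Sn (T i x))) -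
      (\1_B (T ord0 x) * (\1_Sp (T ord0 x) - \1_Sn (T ord0 x)))) /\
      0 <= `|a i x| * (\1_B (T i x) - \1_B (T ord0 x))}.
    apply: filterS HS => x Hx i.
    have [->|i0] := eqVneq i ord0; first by rewrite !subrr !mulr0.
    (* [B] is a sublevel set of [theta], so it contains [T i x] as soon as it contains
       [T ord0 x]. *)
    have b01 : \1_B (T ord0 x) <= \1_B (T i x) :> R.
      rewrite !indicE ler_nat; have [|//] := boolP (T ord0 x \in B).
      rewrite inE => Bx; rewrite (@mem_set _ B (T i x))//.
      exact: le_trans (theta_le _ i0) Bx.
    have s01 : a i x * (\1_Sp (T ord0 x) - \1_Sn (T ord0 x)) <= `|a i x|.
      apply: le_trans (ler_norm _) _; rewrite normrM ler_piMr// !indicE.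
      by do 2 case: (_ \in _);
        rewrite ?subrr ?subr0 ?sub0r ?normrN ?normr0 ?normr1.
    split; last by rewrite mulr_ge0// subr_ge0.
    by apply: key => //; exact: Hx.
  have qp : {ae mu, forall x, q x <= p x}.
    apply: filterS terms => x Hx; rewrite -subr_ge0 pqE; apply: sumr_ge0 => i _.
    by have [/(le_trans _)h /h] := Hx i.
  have mass01 w S x : (forall i x, 0 <= w i x) ->
      (forall x, \sum_(i < k.+1) w i x = 1) ->
      0 <= graph_mass w S x <= 1.
    by move=> w0 w1; rewrite graph_mass_ge0// graph_mass_le1.
  have pq : {ae mu, forall x, p x = q x}.
    apply: (@ae_eq_le_integral _ _ _ _ p q 2) => //.
    - by apply: measurable_funD; exact: measurable_graph_mass.
    - by apply: measurable_funD; exact: measurable_graph_mass.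
    - by move=> x; apply: le2; exact: mass01.
    - by move=> x; apply: le2; exact: mass01.
    - have intD (w v : 'I_k.+1 -> borelType X -> R) S S' :
        (forall i, measurable_fun setT (w i)) ->
        (forall i, measurable_fun setT (v i)) ->
        (forall i x, 0 <= w i x) -> (forall i x, 0 <= v i x) ->
        measurable S -> measurable S' ->
        (\int[mu]_x (graph_mass w S x + graph_mass v S' x)%:E =
        \int[mu]_x (graph_mass w S x)%:E + \int[mu]_x (graph_mass v S' x)%:E)%E.
        move=> mw mv w0 v0 mS mS'; under eq_integral do rewrite EFinD.
        rewrite ge0_integralD//.
        + by move=> x _; rewrite lee_fin graph_mass_ge0.
        + by apply/measurable_EFinP; exact: measurable_graph_mass.
        + by move=> x _; rewrite lee_fin graph_mass_ge0.
        + by apply/measurable_EFinP; exact: measurable_graph_mass.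
      by rewrite !intD// !marginal//; exact: measurableI.
  apply: filterS2 terms pq => x Hx pqx _ [<-] i it t0.
  have D0 : p x - q x = 0 by rewrite pqx subrr.
  (* Nonnegative terms with sum at most 0 all vanish; a threshold that separates the two values of
     [theta] makes the factor of [|a i x|] equal to 1. *)
  have : \sum_(i < k.+1) `|a i x| * (\1_B (T i x) - \1_B (T ord0 x)) <= 0.
    by rewrite -[leRHS]D0 pqE; apply: ler_sum => j _; have [] := Hx j.
  rewrite le_eqVlt ltNge sumr_ge0 ?orbF; last by move=> j _; have [] := Hx j.
  rewrite psumr_eq0; last by move=> j _; have [] := Hx j.
  move=> /allP /(_ i (mem_index_enum _)) /=.
  rewrite !indicE mem_set// memNset; last first.
    by rewrite /B /=; apply/negP; rewrite -ltNge.
  by rewrite subr0 mulr1 normr_eq0 => /eqP.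
apply: filterS aet => x Hx i Tix.
have i0 : i != ord0 by apply: contra_notN Tix => /eqP ->.
have : theta (T i x) < theta (T ord0 x).
  rewrite lt_neqAle theta_le// andbT; apply/eqP => /(theta_eq i0) h.
  by apply: Tix; rewrite h.
move=> /rat_in_itvoo[t]; rewrite in_itv/= => /andP[it t0].
apply/eqP; rewrite -subr_eq0; apply/eqP.
by apply: (Hx (pickle t) t) => //; [rewrite pickleK|exact: ltW].
Qed.

End graph_weights.

(** * Uniqueness of the plan *)

Theorem theorem4p1 (R : realType) (X Y : ptopologicalType)
  (polishX : polish R X) (polishY : polish R Y)
  (mu : probability (borelType X) R) (nu : probability (borelType Y) R)
  (k : nat) (T : 'I_k.+1 -> X -> Y)
  (mT : forall i : 'I_k.+1,
     measurable_fun [set: borelType X] (T i : borelType X -> borelType Y))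
  (injT : forall i : 'I_k.+1, i != ord0 -> injective (T i))
  (disjT : forall i j : 'I_k.+1, i != ord0 -> j != ord0 -> i != j ->
     range (T i) `&` range (T j) = set0)
  (thetaT : exists theta : borelType Y -> R,
     [/\ bounded_fun theta,
         measurable_fun [set: borelType Y] theta &
         forall i : 'I_k.+1, i != ord0 ->
           (forall x : X, 0 <= theta (T ord0 x) - theta (T i x)) /\
           (forall x : X,
              theta (T ord0 x) - theta (T i x) = 0 <-> T ord0 x = T i x)]) :
  forall gamma1 gamma2 : probability (borelType (X * Y)) R,
    transport_plans mu nu gamma1 -> supported_on_graphs mu T gamma1 ->
    transport_plans mu nu gamma2 -> supported_on_graphs mu T gamma2 ->
    forall S : set (borelType (X * Y)), measurable S -> gamma1 S = gamma2 S.
Proof.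
move=> gamma1 gamma2 [_ snd1] [alpha [malpha alpha0 alpha1 gammaE1]].
move=> [_ snd2] [beta [mbeta beta0 beta1 gammaE2]] S mS.
have [theta [_ mtheta thetaP]] := thetaT.
have massE1 A : measurable A ->
    gamma1 A = (\int[mu]_x (graph_mass T alpha A x)%:E)%E.
  by move=> mA; rewrite gammaE1// integral_graph_mass.
have massE2 A : measurable A ->
    gamma2 A = (\int[mu]_x (graph_mass T beta A x)%:E)%E.
  by move=> mA; rewrite gammaE2// integral_graph_mass.
have aeT : {ae mu, forall x, forall i,
    T i x <> T ord0 x -> alpha i x = beta i x}.
  apply: (@graph_weights_ae _ _ _ _ _ _ mT polishX polishY _ _ malpha alpha0
    alpha1 mbeta beta0 beta1 injT disjT theta) => //.
  - by move=> i x i0; rewrite -subr_ge0; exact: (thetaP i i0).1.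
  - move=> i x i0 tE; apply/((thetaP i i0).2 x).
    by rewrite tE subrr.
  - move=> B mB.
    have mB' : measurable (snd @^-1` B : set (borelType (X * Y))).
      by rewrite -[X in measurable X]setTI; exact: measurable_snd_borel.
    by rewrite -massE1// -massE2// [LHS]snd1// [RHS]snd2.
rewrite massE1// massE2//; apply: ae_eq_integral => //.
- by apply/measurable_EFinP; exact: measurable_graph_mass.
- by apply/measurable_EFinP; exact: measurable_graph_mass.
apply: (@filterS _ _ (ae_filter_ringOfSetsType mu) _ _ _ aeT) => x Hx _.
congr EFin; apply/eqP; rewrite -subr_eq0.
rewrite graph_massB// big1// => i _.
(* Where [T i] meets [T ord0] the weights may differ but the indicators cancel; elsewhere the
   weights agree. *)
have [->|/Hx ->] := pselect (T i x = T ord0 x); first by rewrite subrr mulr0.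
by rewrite subrr mul0r.
Qed.
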